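(* Let $\psi_j,\psi_j^\vee$ ($j\ge0$) be the biorthogonal sections for the pairing $\langle\varphi,\varphi^\vee\rangle=\int_\gamma Y\varphi\varphi^\vee$. For $k\ge0$ let $\Psi_k(z),\Psi_k^\vee(z)$ be the $r\times r$ matrices $$\big(\Psi_k(z)\big)_{ab}=\psi_{rk+a-1}(z^{(b)}),\qquad \big(\Psi_k^\vee(z)\big)_{ab}=\psi^\vee_{rk+b-1}(z^{(a)}),\qquad a,b=1,\dots,r.$$ Then there exist $r\times r$ matrix-valued polynomials $P_k(z),P_k^\vee(z)$ of degree $k$ such that $$\Psi_k(z)=P_k(z)\Phi(z),\qquad \Psi_k^\vee(z)=\Phi^\vee(z)P_k^\vee(z),$$ where, for arbitrary bases $\{\varphi_\ell\}_{\ell=1}^r$ of $H^0(\mathcal X\otimes\sqrt{\mathcal K}(\Xi))$ and $\{\varphi_\ell^\vee\}_{\ell=1}^r$ of $H^0(\mathcal X^\vee\otimes\sqrt{\mathcal K}(\Xi))$, $$\Phi_{ab}(z)=\varphi_a(z^{(b)}),\qquad \Phi^\vee_{ab}(z)=\varphi_b^\vee(z^{(a)}).$$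
   Context: $\mathcal C$ is a compact Riemann surface of genus $g$ with canonical bundle $\mathcal K$, and $\sqrt{\mathcal K}$ is a fixed holomorphic square root of $\mathcal K$ with $h^0(\sqrt{\mathcal K})=0$. $\mathcal X$ is a flat line bundle given by a unitary character $\mathcal X:\pi_1(\mathcal C)\to U(1)$, and $\mathcal X^\vee$ is the dual one (inverse character); standing assumption: $h^0(\mathcal X\otimes\sqrt{\mathcal K})=0$ (hence also $h^0(\mathcal X^\vee\otimes\sqrt{\mathcal K})=0$). For a divisor $\mathscr D$, $H^0(\mathcal X\otimes\sqrt{\mathcal K}(\mathscr D))$ is the space of meromorphic sections $\varphi$ of $\mathcal X\otimes\sqrt{\mathcal K}$ with $\mathrm{div}(\varphi)\ge-\mathscr D$. $Z:\mathcal C\to\mathbb C\mathbb P^1$ is a meromorphic function of degree $r$ with polar divisor $\Xi$. $\mathscr D_n$ ($n\ge0$) is a strictly increasing sequence of positive divisors, $\deg\mathscr D_n=n$, of the form $\mathscr D_{kr+\ell}=k\Xi+\mathscr R_\ell$, $0\le\ell\le r-1$, with $\mathscr R_\ell\le\Xi$ a positive divisor of degree $\ell$. Set $\mathscr P_n:=H^0(\mathcal X\otimes\sqrt{\mathcal K}(\mathscr D_{n+1}))$, $\mathscr P_n^\vee:=H^0(\mathcal X^\vee\otimes\sqrt{\mathcal K}(\mathscr D_{n+1}))$ (dimension $n+1$; $\mathscr P_{-1}=\mathscr P_{-1}^\vee=\{0\}$). $\gamma\subset\mathcal C$ is an oriented contour not meeting the divisors $\mathscr D_n$ and $Y:\gamma\to\mathbb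 C$ is a smooth function (all integrals are assumed convergent). A section $\psi_n\in\mathscr P_n$ is a biorthogonal section if $\langle\psi_n,\varphi^\vee\rangle=0$ for all $\varphi^\vee\in\mathscr P^\vee_{n-1}$; $\psi_n^\vee\in\mathscr P_n^\vee$ is biorthogonal if $\langle\varphi,\psi_n^\vee\rangle=0$ for all $\varphi\in\mathscr P_{n-1}$. It is assumed that $D_n:=\det[\langle\chi_a,\chi_b^\vee\rangle]_{a,b=0}^{n-1}\ne0$ for all $n\geq 1$, where $\chi_a$ (resp. $\chi_a^\vee$) is any sequence with $\chi_a$ spanning $\mathscr P_a$ mod $\mathscr P_{a-1}$ (resp. dually); then the biorthogonal sections, unique up to nonzero scalars, can be chosen so that $\psi_n$ spans $\mathscr P_n$ mod $\mathscr P_{n-1}$ and $\psi_n^\vee$ spans $\mathscr P_n^\vee$ mod $\mathscr P_{n-1}^\vee$. The points $z^{(1)},\dots,z^{(r)}$ are the points of $Z^{-1}(z)$, labelled on the complement of a dissection of the $z$-plane; $\varphi(z^{(a)})$ is the value in the fibre of the line bundle at $z^{(a)}$. *)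

(* Defs.v *)
From HB Require Import structures.
From mathcomp Require Import all_boot all_order all_algebra.
From mathcomp Require Import all_classical all_reals all_analysis.
From mathcomp Require Import complex.
Set Implicit Arguments.
Unset Strict Implicit.
Unset Printing Implicit Defensive.
Import Order.TTheory GRing.Theory Num.Theory.
Import numFieldNormedType.Exports.
Local Open Scope classical_set_scope.
Local Open Scope ring_scope.

(* Packaging [R[i]] as a [numClosedFieldType] makes the canonical norm topology
   of a numeric field available on it. *)
Definition Cplx (R : realType) : numClosedFieldType := R[i].

Section Germs.
Variables (R : realType) (X : topologicalType).
Local Notation C := (Cplx R).

(* [x] is a local coordinate near [p].  The Laurent expansion
     f q = \sum_n a_n (x q - x p)^(n - m)
   holds for all q near p, where q = p is excluded if m > 0: the value that [f]
   takes at a pole is meaningless, its value at any other point is not. *)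
Definition laurent (x f : X -> C) (p : X) (m : nat) (a : nat -> C) : Prop :=
  \forall q \near p, (q = p -> m = 0%N) ->
    series (fun n => a n * (x q - x p) ^+ n) @ \oo --> (x q - x p) ^+ m * f q.

(* Holomorphic functions are those with a convergent power series expansion. *)
Definition holomorphic_at (x f : X -> C) (p : X) : Prop :=
  exists a, laurent x f p 0 a.

(* ord_p f >= - m *)
Definition ord_ge_opp (x f : X -> C) (p : X) (m : nat) : Prop :=
  exists a, laurent x f p m a.

(* ord_p f = - m *)
Definition ord_eq_opp (x f : X -> C) (p : X) (m : nat) : Prop :=
  exists a, laurent x f p m a /\ a 0%N != 0.

End Germs.

(* Charts are total functions, of which only the restriction of [coord i] to
   [dom i] matters.  The clauses [coord_inj], [coord_cont] and [coord_open] say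
   that this restriction is a homeomorphism onto an open subset of C. *)
Record riemann_surface (R : realType) (X : topologicalType) := RiemannSurface {
  chart : Type;
  dom : chart -> set X;
  coord : chart -> X -> Cplx R;
  surface_hausdorff : hausdorff_space X;
  surface_connected : connected [set: X];
  chart_cover : forall p, exists i, dom i p;
  dom_open : forall i, open (dom i);
  coord_inj : forall i, {in dom i &, injective (coord i)};
  coord_cont : forall i, {within dom i, continuous (coord i)};
  coord_open : forall i (V : set X),
    open V -> V `<=` dom i -> open (coord i @` V);
  coord_change : forall i j p, dom i p -> dom j p ->
    holomorphic_at (coord i) (coord j) p
}.

Section Surface.
Variables (R : realType) (X : topologicalType) (S : riemann_surface R X).
Local Notation C := (Cplx R).

Definition chart_at (p : X) : chart S := projT1 (cid (chart_cover S p)).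

Definition is_divisor (D : X -> nat) : Prop :=
  finite_set [set p | D p != 0%N].

Definition divisor_deg (D : X -> nat) : nat := \sum_(p \in [set: X]) D p.

(* Line bundles are given by transition functions over the atlas, and their
   sections by the local representatives [s i], with [s i = g i j * s j] over
   [dom i `&` dom j].  When the charts are discs, which is not required, every
   line bundle on the surface is of this form. *)

Definition cocycle := chart S -> chart S -> X -> C.
Definition section := chart S -> X -> C.

Definition is_cocycle (g : cocycle) : Prop :=
  (forall i p, dom i p -> g i i p = 1) /\
  (forall i j k p, dom i p -> dom j p -> dom k p ->
     g i j p * g j k p = g i k p).

Definition line_bundle (g : cocycle) : Prop :=
  is_cocycle g /\
  (forall i j p, dom i p -> dom j p -> holomorphic_at (coord i) (g i j) p).

Definition tensor (g h : cocycle) : cocycle := fun i j p => g i j p * h i j p.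

Definition dual (g : cocycle) : cocycle := fun i j p => (g i j p)^-1.

(* f_i dx_i = f_j dx_j means f_i = (dx_j / dx_i) f_j. *)
Definition canonical_bundle : cocycle := fun i j p =>
  lim ((coord j q - coord j p) / (coord i q - coord i p) @[q --> p^']).

Definition sqrt_canonical (h : cocycle) : Prop :=
  line_bundle h /\
  (forall i j p, dom i p -> dom j p ->
     tensor h h i j p = canonical_bundle i j p).

(* Characters of the fundamental group, as homotopy invariant and
   multiplicative functions of loops; a loop is a map on [0, 1], extended
   arbitrarily to R. *)

Definition is_loop (x0 : X) (l : R -> X) : Prop :=
  [/\ {within `[0, 1], continuous l}, l 0 = x0 & l 1 = x0].

Definition loop_homotopic (x0 : X) (l l' : R -> X) : Prop :=
  exists H : R * R -> X,
    {within `[0, 1] `*` `[0, 1], continuous H} /\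
    (forall t, 0 <= t <= 1 ->
       [/\ H (0, t) = l t, H (1, t) = l' t, H (t, 0) = x0 & H (t, 1) = x0]).

Definition loop_mul (l l' : R -> X) : R -> X :=
  fun t => if t <= 2^-1 then l (2 * t) else l' (2 * t - 1).

Definition unitary_character (x0 : X) (chi : (R -> X) -> C) : Prop :=
  [/\ forall l, is_loop x0 l -> `|chi l| = 1,
      forall l l', is_loop x0 l -> is_loop x0 l' ->
        loop_homotopic x0 l l' -> chi l = chi l'
    & forall l l', is_loop x0 l -> is_loop x0 l' ->
        chi (loop_mul l l') = chi l * chi l'].

(* The loop [l] runs through the charts s_0, ..., s_(n-1), s_n = s_0, passing
   from s_k to s_(k+1) at time t_(k+1).  The continuation along [l] of the
   germ s_(s_0) of a local section is then chi(l) times itself, where chi(l)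
   is the product of the (locally constant) transition functions met. *)
Definition has_monodromy (x0 : X) (chi : (R -> X) -> C) (g : cocycle) : Prop :=
  forall (l : R -> X) (n : nat) (t : nat -> R) (s : nat -> chart S),
    is_loop x0 l -> t 0%N = 0 -> t n = 1 -> s n = s 0%N ->
    (forall k, (k < n)%N -> t k <= t k.+1 /\
       (forall u, t k <= u <= t k.+1 -> dom (s k) (l u))) ->
    chi l = \prod_(k < n) g (s k) (s k.+1) (l (t k.+1)).

Definition flat_bundle (x0 : X) (chi : (R -> X) -> C) (g : cocycle) : Prop :=
  [/\ is_cocycle g,
      forall i j p, dom i p -> dom j p -> `|g i j p| = 1,
      forall i j p, dom i p -> dom j p -> \forall q \near p, g i j q = g i j p
    & has_monodromy x0 chi g].

(* Meromorphic sections.  A section of [g(D)] is holomorphic, with a meaningful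
   value in the fibre, at every point outside the support of [D]; values at
   points of the support are ignored, so that equality of sections is equality
   near every point, that point being excluded. *)

Definition mero_eq (s s' : section) : Prop :=
  forall i p, dom i p -> \forall q \near p^', s i q = s' i q.

Definition H0 (g : cocycle) (D : X -> nat) : set section :=
  [set s | (forall i j p, dom i p -> dom j p -> D p = 0%N ->
              s i p = g i j p * s j p) /\
           (forall i p, dom i p -> ord_ge_opp (coord i) (s i) p (D p))].

Definition lincomb (n : nat) (c : 'I_n -> C) (b : 'I_n -> section) : section :=
  fun i p => \sum_l c l * b l i p.

Definition is_trivial (V : set section) : Prop :=
  forall s, V s -> mero_eq s (fun _ _ => 0).

Definition is_basis (n : nat) (V : set section) (b : 'I_n -> section) : Prop :=
  [/\ forall l, V (b l),
      forall c, mero_eq (lincomb c b) (fun _ _ => 0) -> forall l, c l = 0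
    & forall s, V s -> exists c, mero_eq s (lincomb c b)].

Definition spans_mod (V W : set section) (s : section) : Prop :=
  V s /\ (forall s', V s' -> exists (c : C) (w : section),
            W w /\ mero_eq s' (fun i p => c * s i p + w i p)).

(* The genus, as the dimension of the space of holomorphic differentials. *)
Definition has_genus (n : nat) : Prop :=
  exists b : 'I_n -> section, is_basis (H0 canonical_bundle (fun=> 0%N)) b.

(* CP^1 is [option C], with [None] the point at infinity. *)
Definition mero_function (Z : X -> option C) (Xi : X -> nat) : Prop :=
  [/\ is_divisor Xi,
      forall p, Z p = None <-> Xi p != 0%N
    & forall (i : chart S) p, dom i p ->
        let Zfin := fun q => odflt 0 (Z q) in
        if Xi p == 0%N then holomorphic_at (coord i) Zfin p
        else ord_eq_opp (coord i) Zfin p (Xi p)].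

(* Contours are finite families of smooth arcs parametrized by ]0, 1[.  The
   endpoints are not part of an arc, so that noncompact arcs, ending at points
   of the divisors, are allowed. *)

Definition Re_of (f : R -> C) : R -> R := fun t => complex.Re (f t : R[i]).
Definition Im_of (f : R -> C) : R -> R := fun t => complex.Im (f t : R[i]).

Definition smooth_at (f : R -> C) (t : R) : Prop :=
  forall n, derivable (derive1n n (Re_of f)) t 1 /\ derivable (derive1n n (Im_of f)) t 1.

Definition velocity (f : R -> C) (t : R) : C :=
  Complex (derive1 (Re_of f) t) (derive1 (Im_of f) t).

Definition contour (N : nat) (gam : 'I_N -> R -> X) : Prop :=
  forall (j : 'I_N) (t : R), 0 < t < 1 ->
    {for t, continuous (gam j)} /\
    (forall i : chart S, dom i (gam j t) -> smooth_at (coord i \o gam j) t).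

Definition smooth_on (N : nat) (gam : 'I_N -> R -> X) (Y : X -> C) : Prop :=
  forall (j : 'I_N) (t : R), 0 < t < 1 -> smooth_at (Y \o gam j) t.

Definition cintegrable (f : R -> C) : Prop :=
  (@lebesgue_measure R).-integrable `]0, 1[ (EFin \o Re_of f) /\
  (@lebesgue_measure R).-integrable `]0, 1[ (EFin \o Im_of f).

Definition cintegral (f : R -> C) : C :=
  Complex (Rintegral (@lebesgue_measure R) `]0, 1[ (Re_of f))
          (Rintegral (@lebesgue_measure R) `]0, 1[ (Im_of f)).

(* The pull-back by [gam] of the differential Y s s'.  It does not depend on
   the chart in which it is computed if [s] and [s'] are sections of bundles
   with tensor product the canonical bundle. *)
Definition pullback (Y : X -> C) (gam : R -> X) (s s' : section) (t : R) : C :=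
  let i := chart_at (gam t) in
  Y (gam t) * s i (gam t) * s' i (gam t) * velocity (coord i \o gam) t.

Definition pairing (N : nat) (gam : 'I_N -> R -> X) (Y : X -> C)
    (s s' : section) : C :=
  \sum_(j < N) cintegral (pullback Y (gam j) s s').

Definition pairing_converges (N : nat) (gam : 'I_N -> R -> X) (Y : X -> C)
    (s s' : section) : Prop :=
  forall j, cintegrable (pullback Y (gam j) s s').

End Surface.

Section MatrixPolynomials.
Variables (F : fieldType) (r : nat).

Definition mpoly_eval (P : 'M[{poly F}]_r) (z : F) : 'M[F]_r :=
  \matrix_(a, b) (P a b).[z].

Definition mpoly_degree (P : 'M[{poly F}]_r) (k : nat) : Prop :=
  (forall a b, (size (P a b) <= k.+1)%N) /\ (exists a b, (P a b)`_k != 0).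

End MatrixPolynomials.

Section Labelling.
Variables (R : realType) (X : topologicalType).
Local Notation C := (Cplx R).

(* [pt a z] is z^(a), for z outside the cuts of a dissection of the plane. *)
Definition labelling (r : nat) (Z : X -> option C) (cut : set C)
    (pt : 'I_r -> C -> X) : Prop :=
  [/\ closed cut, dense (~` cut)
    & forall z, ~ cut z ->
      [/\ forall a, {for z, continuous (pt a)},
          injective (pt^~ z)
        & forall p, Z p = Some z <-> exists a, p = pt a z]].

End Labelling.

(* Main.v *)
Require Import Defs.
From HB Require Import structures.
From mathcomp Require Import all_boot all_order all_algebra.
From mathcomp Require Import all_classical all_reals all_analysis.
From mathcomp Require Import complex ring.
Set Implicit Arguments.
Unset Strict Implicit.
Unset Printing Implicit Defensive.
Import Order.TTheory GRing.Theory Num.Theory.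
Import numFieldNormedType.Exports.
Local Open Scope classical_set_scope.
Local Open Scope ring_scope.

(** Let [g] be [X * sqrt K] or its dual version, let [phi_1, ..., phi_r] be a basis
    of [H0 g Xi], and write [g(m Xi)] for [g] with poles allowed along [m Xi].
    The point is that the [r * m] sections [Z^j phi_c], [j < m], are a basis of the
    sections of [g(m Xi)].  No Riemann-Roch theorem is used for this.

    Multiplication by [Z] raises the order of the poles on the support of [Xi] by
    exactly [Xi].  Hence if [s] is a section of [g(m Xi)] and [Z s] has poles at
    most [Xi], then the singularities of [s] are removable, and [s = 0] because
    [h0(g) = 0] ([scale_finite_part_eq0]).  A relation between the [Z^j phi_c] has
    the form [w + Z T = 0] with [w] in the span of the [phi_c]; so [T = 0] and
    [w = 0], and induction on [m] shows that the [Z^j phi_c] are independent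
    ([power_section_free]).  Since each [psi_n] spans its space modulo the preceding
    one, and since [h0(g) = 0], the sections of [g(m Xi)] are spanned by the
    [r * m] sections [psi_n], [n < r * m].  Comparing the numbers of elements, the
    two families are related by an invertible matrix, and every [psi_n] with
    [n < r * m] is a combination of the [Z^j phi_c] with [j < m]
    ([psi_power_comb]).  For [n = r * k + a] and [m = k + 1], evaluation at the points
    of a fibre of [Z] is the asserted factorization; it is legitimate because
    sections that agree as meromorphic sections have the same value wherever both
    are holomorphic ([mero_eq_value]).

    The degree is exactly [k]: otherwise [psi_(r k)] would belong to the space
    of sections of [g(k Xi)], which precedes it; the zero section would then span
    the next space modulo this one, and putting it in the place of [psi_(r k)]
    would give a vanishing moment determinant ([moments_notin]).

    The analytic input is elementary: Cauchy products of power series, for the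
    Laurent expansion of a product, and the continuity of a power series at its
    centre, for removable singularities and for comparing values. *)

(** * Power series in one complex variable *)

Section PowerSeries.
Variable R : realType.
Local Notation C := (Cplx R).
Implicit Types (a b u v : nat -> C) (t l : C) (rho K : C).

Lemma geometric_half_small (e : C) : 0 < e -> exists n, 2^-1 ^+ n < e.
Proof.
case: e => x y; rewrite ltcE /= => /andP[/eqP y0 x_gt0]; rewrite y0 in x_gt0 *.
have xV_gt0 : 0 < x^-1 by rewrite invr_gt0.
exists (Num.bound x^-1).
have -> : (2^-1 : C) ^+ Num.bound x^-1 = (2^-1 ^+ Num.bound x^-1)%:C%C.
  by rewrite rmorphXn /= fmorphV rmorph_nat.
rewrite ltcR exprVn -[ltRHS]invrK ltf_pV2 ?posrE ?exprn_gt0 //.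
apply: (lt_le_trans (archi_boundP (ltW xV_gt0))).
by rewrite -natrX ler_nat ltnW // ltn_expl.
Qed.

Lemma cvg0_geometric_half K (d : nat -> C) :
  (forall n, `|d n| <= K * 2^-1 ^+ n) -> d n @[n --> \oo] --> 0.
Proof.
move=> dK; have K_ge0 : 0 <= K by have := dK 0; rewrite expr0 mulr1; exact: le_trans.
apply/cvgrPdist_lt => e e_gt0.
have K1_gt0 : 0 < K + 1 by rewrite ltr_wpDl.
have [n0 n0P] := geometric_half_small (divr_gt0 e_gt0 K1_gt0).
exists n0 => // n /= n0n; rewrite sub0r normrN (le_lt_trans (dK n)) //.
rewrite (@le_lt_trans _ _ ((K + 1) * 2^-1 ^+ n0)) //; last first.
  by rewrite mulrC -ltr_pdivlMr.
apply: ler_pM; rewrite ?exprn_ge0 ?lerDl //.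
by rewrite -(subnKC n0n) exprD ler_piMr ?exprn_ge0 ?exprn_ile1 ?invf_le1 ?ler1n.
Qed.

Lemma cvg_ext (T : Type) (F : set_system T) (f g : T -> C) l l' :
  f @ F --> l -> f =1 g -> l = l' -> g @ F --> l'.
Proof. by move=> fl /funext <- <-. Qed.

Lemma cvg_norm_sub_le (s : nat -> C) (l c : C) K :
  s n @[n --> \oo] --> l -> (forall n, `|s n - c| <= K) -> `|l - c| <= K.
Proof.
move=> sl sK; have K_ge0 : 0 <= K by exact: le_trans (sK 0%N).
rewrite real_leNgt ?normr_real ?ger0_real //; apply/negP => lt_K.
have e_gt0 : 0 < `|l - c| - K by rewrite subr_gt0.
move/cvgrPdist_lt/(_ _ e_gt0): sl => [n _ /(_ n (leqnn n))] /=.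
rewrite ltrBrDr => lt1; suff: `|l - c| < `|l - c| by rewrite ltxx.
apply: le_lt_trans lt1; apply: le_trans (lerD (lexx _) (sK n)).
by rewrite -[X in `|X| <= _](subrKA (s n)) ler_normD.
Qed.

(** The Cauchy product of two sequences. *)
Definition convolution u v n : C := \sum_(i < n.+1) u i * v (n - i)%N.

Lemma seriesE u n : series u n = \sum_(i < n) u i.
Proof. by rewrite seriesEord. Qed.

(** The partial sums of a Cauchy product, summed along the rows of the triangle
    [i + j < n]. *)
Lemma series_convolution u v n :
  series (convolution u v) n = \sum_(i < n) u i * series v (n - i)%N.
Proof.
elim: n => [|n IHn]; first by rewrite seriesE !big_ord0.
rewrite seriesSr IHn /convolution.
transitivity (\sum_(i < n.+1) u i * (series v (n - i)%N + v (n - i)%N)).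
  under [RHS]eq_bigr do rewrite mulrDr.
  rewrite big_split /= [in RHS]big_ord_recr /= subnn (seriesE v 0) big_ord0.
  by rewrite mulr0 addr0.
apply: eq_bigr => i _.
by rewrite subSn ?leq_ord // seriesSr.
Qed.

Lemma series_tail K v : (forall n, `|v n| <= K * 4^-1 ^+ n) ->
  forall n m, `|series v (n + m)%N - series v n| <= K * (2 * 4^-1 ^+ n).
Proof.
move=> vK n m; have K_ge0 : 0 <= K by have := vK 0; rewrite expr0 mulr1; exact: le_trans.
(* The subtracted term makes the bound inductive in [m]. *)
suff H : `|series v (n + m)%N - series v n| <=
         K * (2 * 4^-1 ^+ n - 2 * 4^-1 ^+ (n + m)).
  apply: le_trans H _; rewrite ler_wpM2l // gerBl mulr_ge0 // exprn_ge0 //.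
elim: m => [|m IHm]; first by rewrite addn0 !subrr normr0 mulr0.
rewrite addnS seriesSr addrAC (le_trans (ler_normD _ _)) //.
apply: le_trans (lerD IHm (vK _)) _.
rewrite -mulrDr ler_wpM2l // exprS.
rewrite -subr_ge0; set q := 4^-1 ^+ (n + m).
have -> : 2 * 4^-1 ^+ n - 2 * (4^-1 * q) - (2 * 4^-1 ^+ n - 2 * q + q) = 2^-1 * q.
  by rewrite /q; field.
by rewrite mulr_ge0 // exprn_ge0.
Qed.

(** Mertens' theorem for geometrically dominated series. *)
Lemma cvg_series_convolution K K' u v (l l' : C) :
  (forall n, `|u n| <= K * 4^-1 ^+ n) -> (forall n, `|v n| <= K' * 4^-1 ^+ n) ->
  series u @ \oo --> l -> series v @ \oo --> l' ->
  series (convolution u v) @ \oo --> l * l'.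
Proof.
move=> uK vK ul vl'.
have K_ge0 : 0 <= K by have := uK 0; rewrite expr0 mulr1; exact: le_trans.
have K'_ge0 : 0 <= K' by have := vK 0; rewrite expr0 mulr1; exact: le_trans.
pose d n := series u n * series v n - series (convolution u v) n.
have d0 : d n @[n --> \oo] --> 0.
  (* On the missing triangle [i + j >= n] each of the [n] rows contributes
     [O(4^-n)], and [n * 4^-n <= 2^-n]. *)
  apply: (@cvg0_geometric_half (K * (K' * 2))) => n.
  rewrite /d series_convolution seriesE mulr_suml -sumrB.
  under eq_bigr do rewrite -mulrBr.
  apply: le_trans (ler_norm_sum _ _ _) _.
  apply: (@le_trans _ _ (\sum_(i < n) K * (K' * 2) * 4^-1 ^+ n)).
    apply: ler_sum => i _; rewrite normrM.
    apply: (@le_trans _ _ ((K * 4^-1 ^+ i) * (K' * (2 * 4^-1 ^+ (n - i))))).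
      apply: ler_pM => //.
      have := series_tail vK (n - i) i.
      by rewrite subnK // ltnW.
    have -> : (4^-1 : C) ^+ n = 4^-1 ^+ i * 4^-1 ^+ (n - i).
      by rewrite -exprD subnKC // ltnW.
    by rewrite [leLHS](_ : _ = K * (K' * 2) * (4^-1 ^+ i * 4^-1 ^+ (n - i))) //; ring.
  rewrite sumr_const card_ord -mulrnAr ler_wpM2l ?mulr_ge0 //.
  have -> : (4^-1 : C) = 2^-1 * 2^-1 by field.
  rewrite exprMn -mulrnAl -[leRHS]mul1r ler_wpM2r ?exprn_ge0 //.
  rewrite exprVn -mulr_natl ler_pdivrMr ?exprn_gt0 // mul1r -natrX ler_nat.
  by rewrite ltnW // ltn_expl.
apply: cvg_ext (cvgB (cvgM ul vl') d0) _ _; last by rewrite subr0.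
by move=> n; rewrite /d !fctE opprB addrC subrK.
Qed.

(** [psum a t l]: the power series with coefficients [a] converges at [t], with
    sum [l]. *)
Definition psum a t l : Prop := series (fun n => a n * t ^+ n) @ \oo --> l.

Lemma cvg_unique_Cplx (T : Type) (F : set_system T) (FF : ProperFilter F)
  (f : T -> C) l l' : f x @[x --> F] --> l -> f x @[x --> F] --> l' -> l = l'.
Proof. by move=> h h'; apply: cvg_unique h h'; exact: norm_hausdorff. Qed.

Lemma psum_unique a t l l' : psum a t l -> psum a t l' -> l = l'.
Proof. exact: cvg_unique_Cplx. Qed.

Lemma psum0 a : psum a 0 (a 0).
Proof.
rewrite /psum -cvg_shiftS; apply: cvg_ext (cvg_cst (a 0)) _ _ => // n.
rewrite /= seriesE big_ord_recl expr0 mulr1 big1 ?addr0 // => i _.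
by rewrite expr0n mulr0.
Qed.

Lemma psum_zero t : psum (fun=> 0) t 0.
Proof.
apply: cvg_ext (cvg_cst 0) _ _ => // n; rewrite /= seriesE big1 // => i _.
by rewrite mul0r.
Qed.

Lemma psumD a b t l l' : psum a t l -> psum b t l' ->
  psum (fun n => a n + b n) t (l + l').
Proof.
move=> al bl; apply: cvg_ext (cvgD al bl) _ _ => // n.
rewrite /= ?fctE !seriesE -big_split; apply: eq_bigr => i _.
by rewrite mulrDl.
Qed.

Lemma psumZ c a t l : psum a t l -> psum (fun n => c * a n) t (c * l).
Proof.
move=> al; apply: cvg_ext (cvgM (cvg_cst c) al) _ _ => // n.
rewrite /= ?fctE !seriesE mulr_sumr; apply: eq_bigr => i _.
by rewrite mulrA.
Qed.

Lemma psum_shift a t l : t != 0 -> psum a t l ->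
  psum (fun n => a n.+1) t (t^-1 * (l - a 0)).
Proof.
move=> t0; rewrite /psum -cvg_shiftS => al.
apply: cvg_ext (cvgM (cvg_cst t^-1) (cvgB al (cvg_cst (a 0)))) _ _ => // n.
rewrite /= ?fctE !seriesE big_ord_recl expr0 mulr1 addrAC subrr add0r.
rewrite mulr_sumr; apply: eq_bigr => i _.
by rewrite exprS mulrCA mulKf.
Qed.

Lemma psum_unshift a t l m : psum a t l ->
  psum (fun n => if (n < m)%N then 0 else a (n - m)%N) t (t ^+ m * l).
Proof.
move=> al; rewrite /psum -(cvg_shiftn m).
apply: cvg_ext (cvgM (cvg_cst (t ^+ m)) al) _ _ => // n.
rewrite /= ?fctE !seriesE addnC big_split_ord /=.
rewrite [X in _ = X + _]big1 => [|i _]; last by rewrite ltn_ord mul0r.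
rewrite add0r mulr_sumr; apply: eq_bigr => i _.
by rewrite ltnNge leq_addr /= addKn exprD mulrCA.
Qed.

(** Cauchy's estimate for the coefficients of a convergent series. *)
Lemma psum_bound a t l : psum a t l ->
  exists K, 0 < K /\ forall n, `|a n| * `|t| ^+ n <= K.
Proof.
move=> /cvgP/cvg_series_cvg_0/cvgP/cvg_seq_bounded/pinfty_ex_gt0[K K0 aK].
by exists K; split=> // n; have := aK n I; rewrite /= normrM normrX.
Qed.

(** Cauchy's estimates at radius [rho] turn into domination by [4^-n] when
    [|t| <= rho / 4]. *)
Lemma psum_mul rho K K' a b t l l' : 0 < rho ->
  (forall n, `|a n| * rho ^+ n <= K) -> (forall n, `|b n| * rho ^+ n <= K') ->
  `|t| <= rho / 4 -> psum a t l -> psum b t l' ->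
  psum (convolution a b) t (l * l').
Proof.
move=> rho0 aK bK tr al bl.
have dom c K0 : (forall n, `|c n| * rho ^+ n <= K0) ->
    forall n, `|c n * t ^+ n| <= K0 * 4^-1 ^+ n.
  move=> cK n; rewrite normrM normrX.
  apply: (@le_trans _ _ (`|c n| * (rho ^+ n * 4^-1 ^+ n))).
    by rewrite ler_wpM2l // -exprMn lerXn2r // ?nnegrE ?divr_ge0 // ltW.
  by rewrite mulrA ler_wpM2r // exprn_ge0.
rewrite /psum; suff -> : (fun n => convolution a b n * t ^+ n) =
    convolution (fun n => a n * t ^+ n) (fun n => b n * t ^+ n).
  exact: cvg_series_convolution (dom _ _ aK) (dom _ _ bK) al bl.
apply/funext => n; rewrite /convolution mulr_suml; apply: eq_bigr => i _.
have -> : t ^+ n = t ^+ i * t ^+ (n - i) by rewrite -exprD subnKC // leq_ord.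
by rewrite mulrACA.
Qed.

(** A power series is Lipschitz at the origin. *)
Lemma psum_sub0 rho K a t l : 0 < rho -> (forall n, `|a n| * rho ^+ n <= K) ->
  `|t| <= rho / 4 -> psum a t l -> `|l - a 0| <= K / rho * 2 * `|t|.
Proof.
move=> rho0 aK tr al.
have K_ge0 : 0 <= K by have := aK 0; rewrite expr0 mulr1; exact: le_trans.
have [t0|t0] := eqVneq t 0.
  rewrite t0 in al *; rewrite (psum_unique al (@psum0 a)) subrr !normr0.
  by rewrite mulr0.
have tail0 : forall n, `|series (fun n => a n.+1 * t ^+ n) n - 0| <= K / rho * 2.
  move=> n.
  have := @series_tail (K / rho) (fun n => a n.+1 * t ^+ n) _ 0 n.
  rewrite add0n (seriesE _ 0) big_ord0 expr0 mulr1; apply => {}n.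
  rewrite normrM normrX.
  apply: (@le_trans _ _ (`|a n.+1| * (rho ^+ n * 4^-1 ^+ n))).
    by rewrite ler_wpM2l // -exprMn lerXn2r // ?nnegrE ?divr_ge0 // ltW.
  rewrite mulrA ler_wpM2r ?exprn_ge0 // ler_pdivlMr // -mulrA -exprSr.
  exact: aK.
have := cvg_norm_sub_le (psum_shift t0 al) tail0.
rewrite subr0 normrM normfV mulrC ler_pdivrMr ?normr_gt0 //.
Qed.
End PowerSeries.

(** * Laurent expansions in a local coordinate *)

Section LaurentExpansions.
Variables (R : realType) (X : topologicalType).
Local Notation C := (Cplx R).
Implicit Types (x f h : X -> C) (p : X) (a b : nat -> C).

(** What the arguments below use of a chart [x] at [p]: it is continuous and
    injective at [p], and [p] is not an isolated point of the surface. *)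
Definition local_coordinate x p : Prop :=
  [/\ {for p, continuous x}, \forall q \near p, x q = x p -> q = p
    & ProperFilter p^'].

(** Laurent expansions that say nothing of the value of [f] at [p]. *)
Definition punctured_laurent x f p m a : Prop :=
  \forall q \near p^', psum a (x q - x p) ((x q - x p) ^+ m * f q).

Lemma near_dnbhs p (P : X -> Prop) :
  (\forall q \near p^', P q) = (\forall q \near p, q != p -> P q).
Proof. by []. Qed.

Lemma laurentP x f p m a :
  laurent x f p m a <-> punctured_laurent x f p m a /\ (m = 0 -> f p = a 0)%N.
Proof.
split=> [fa|[fa fp]].
  split.
    have : \forall q \near p^', q != p by exact: nbhs_dnbhs_neq.
    have : \forall q \near p^', (q = p -> m = 0%N) ->
        psum a (x q - x p) ((x q - x p) ^+ m * f q) by exact: nbhs_dnbhs.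
    by apply: filterS2 => q fq /eqP qp; apply: fq => /qp.
  move=> m0; move: fa => /nbhs_singleton /(_ (fun=> m0)).
  by rewrite m0 subrr expr0 mul1r => /psum_unique /(_ (@psum0 _ a)).
move: fa; rewrite /punctured_laurent near_dnbhs; apply: filterS => q fq qm.
have [qp|/fq//] := eqVneq q p.
by rewrite qp subrr (qm qp) expr0 mul1r fp ?qm //; exact: psum0.
Qed.

Lemma coord_small x p (e : C) : local_coordinate x p -> 0 < e ->
  \forall q \near p^', x q - x p != 0 /\ `|x q - x p| <= e.
Proof.
move=> [xc xi _] e0.
have xe : \forall q \near p, `|x p - x q| <= e by move: xc => /cvgrPdist_le; exact.
rewrite near_dnbhs; apply: filterS2 xi xe => q qi qe /eqP qp.
split; last by rewrite distrC.
by rewrite subr_eq0; apply/eqP => /qi.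
Qed.

(** The expansion converges at points [q != p], and [rho] is the size of the
    coordinate of one of them. *)
Lemma punctured_laurent_bound x f p m a : local_coordinate x p ->
  punctured_laurent x f p m a ->
  exists rho K : C, [/\ 0 < rho, 0 < K & forall n, `|a n| * rho ^+ n <= K].
Proof.
move=> xp fa; have [_ _ pp] := xp.
have [q [[t0 _] /psum_bound[K [K0 aK]]]] := filter_ex (filterI (coord_small xp ltr01) fa).
by exists `|x q - x p|, K; split=> //; rewrite normr_gt0.
Qed.

Lemma punctured_laurentM x f h p m m' a b : local_coordinate x p ->
  punctured_laurent x f p m a -> punctured_laurent x h p m' b ->
  punctured_laurent x (fun q => f q * h q) p (m + m') (convolution a b).
Proof.
move=> xp fa hb.
have [r1 [K1 [r1_gt0 _ aK]]] := punctured_laurent_bound xp fa.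
have [r2 [K2 [r2_gt0 _ bK]]] := punctured_laurent_bound xp hb.
(* A radius smaller than both, without comparing them. *)
pose rho := (r1^-1 + r2^-1)^-1.
have rV_gt0 : 0 < r1^-1 + r2^-1 by rewrite addr_gt0 ?invr_gt0.
have rho_gt0 : 0 < rho by rewrite invr_gt0.
have rho1 : rho <= r1.
  by rewrite -[leRHS]invrK lef_pV2 ?posrE ?invr_gt0 // lerDl invr_ge0 ltW.
have rho2 : rho <= r2.
  by rewrite -[leRHS]invrK lef_pV2 ?posrE ?invr_gt0 // lerDr invr_ge0 ltW.
have shrink (c : nat -> C) r K : rho <= r -> (forall n, `|c n| * r ^+ n <= K) ->
    forall n, `|c n| * rho ^+ n <= K.
  move=> rr cK n; apply: le_trans (cK n); rewrite ler_wpM2l //.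
  by rewrite lerXn2r // nnegrE ltW // (lt_le_trans rho_gt0).
have e_gt0 : 0 < rho / 4 by rewrite divr_gt0.
apply: filterS2 (coord_small xp e_gt0) (filterI fa hb) => q [_ qe] [fq hq].
have := psum_mul rho_gt0 (shrink _ _ _ rho1 aK) (shrink _ _ _ rho2 bK) qe fq hq.
by rewrite mulrACA exprD.
Qed.

Lemma punctured_laurentD x f h p m a b :
  punctured_laurent x f p m a -> punctured_laurent x h p m b ->
  punctured_laurent x (fun q => f q + h q) p m (fun n => a n + b n).
Proof. by apply: filterS2 => q fq hq; rewrite mulrDr; exact: psumD. Qed.

Lemma punctured_laurentZ x f p m a c :
  punctured_laurent x f p m a ->
  punctured_laurent x (fun q => c * f q) p m (fun n => c * a n).
Proof. by apply: filterS => q fq; rewrite mulrCA; exact: psumZ. Qed.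

Lemma punctured_laurent_widen x f p m m' a : (m <= m')%N ->
  punctured_laurent x f p m a -> exists b, punctured_laurent x f p m' b.
Proof.
move=> mm' fa.
exists (fun n => if (n < m' - m)%N then 0 else a (n - (m' - m))%N).
apply: filterS fa => q /(@psum_unshift _ _ _ _ (m' - m)%N).
by rewrite mulrA -exprD subnK.
Qed.

Lemma punctured_laurent_lim x f p m a : local_coordinate x p ->
  punctured_laurent x f p m a ->
  (x q - x p) ^+ m * f q @[q --> p^'] --> a 0.
Proof.
move=> xp fa; have [_ _ pp] := xp.
have [rho [K [rho_gt0 K_gt0 aK]]] := punctured_laurent_bound xp fa.
apply/cvgrPdist_le => e e_gt0.
have M_gt0 : 0 < K / rho * 2 by rewrite mulr_gt0 // divr_gt0.
have d1 : 0 < rho / 4 by rewrite divr_gt0.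
have d2 : 0 < e / (K / rho * 2) by rewrite divr_gt0.
apply: filterS3 (coord_small xp d1) (coord_small xp d2) fa => q [_ q1] [_ q2] fq.
rewrite distrC (le_trans (psum_sub0 rho_gt0 aK q1 fq)) //.
by rewrite mulrC -ler_pdivlMr.
Qed.

(** A vanishing leading coefficient lowers the order of the pole. *)
Lemma punctured_laurent_lower x f p m a : local_coordinate x p -> a 0%N = 0 ->
  punctured_laurent x f p m.+1 a ->
  punctured_laurent x f p m (fun n => a n.+1).
Proof.
move=> xp a0; apply: filterS2 (coord_small xp ltr01) => q [t0 _] fq.
have := psum_shift t0 fq.
by rewrite a0 subr0 exprS -mulrA mulKf.
Qed.

(** If [z] has a pole of order [n] exactly, and [z * f] a pole of order at most
    [n], then the singularity of [f] is removable. *)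
Lemma removable_singularity x f z w p m n a b c : local_coordinate x p ->
  punctured_laurent x f p m a -> punctured_laurent x z p n b -> b 0%N != 0 ->
  punctured_laurent x w p n c -> (\forall q \near p^', z q * f q = w q) ->
  exists a', punctured_laurent x f p 0 a'.
Proof.
move=> xp + zb b0 wc zf; have [_ _ pp] := xp.
(* If the pole of [f] has order at most [m.+1], then near [p] the function
   [x^n z * x^(m.+1) f = x^(m.+1) * x^n w] tends to [b 0 * a 0] and to [0]. *)
elim: m a => [|m IHm] a fa; first by exists a.
suff a0 : a 0%N = 0 by apply: (IHm (fun n => a n.+1)); exact: punctured_laurent_lower.
have w_lim := punctured_laurent_lim xp wc.
have x_lim : x q - x p @[q --> p^'] --> (0 : C).
  apply/cvgrPdist_le => e e_gt0; apply: filterS (coord_small xp e_gt0) => q [_].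
  by rewrite sub0r normrN.
have xm_lim : (x q - x p) ^+ m.+1 @[q --> p^'] --> (0 : C).
  elim: (m) => [|k IHk]; first exact: x_lim.
  apply: cvg_ext (cvgM x_lim IHk) _ _ => [q|]; last by rewrite mulr0.
  by rewrite exprS.
have zf_lim : ((x q - x p) ^+ n * z q) * ((x q - x p) ^+ m.+1 * f q) @[q --> p^']
    --> b 0%N * a 0%N.
  exact: cvgM (punctured_laurent_lim xp zb) (punctured_laurent_lim xp fa).
have xw_lim : (x q - x p) ^+ m.+1 * ((x q - x p) ^+ n * w q) @[q --> p^']
    --> 0 * c 0%N.
  exact: cvgM xm_lim w_lim.
have /eqP : b 0%N * a 0%N = 0 * c 0%N.
  apply: cvg_unique_Cplx zf_lim _; apply: cvg_trans xw_lim; apply: near_eq_cvg.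
  apply: filterS zf => q <-; ring.
by rewrite mul0r mulf_eq0 (negbTE b0) => /eqP.
Qed.

Lemma holomorphic_continuous x f p : local_coordinate x p ->
  holomorphic_at x f p -> {for p, continuous f}.
Proof.
move=> xp [a /laurentP[fa /(_ erefl) fp]].
have f_lim : f q @[q --> p^'] --> f p.
  apply: cvg_ext (punctured_laurent_lim xp fa) _ _ => // q.
  by rewrite expr0 mul1r.
apply/cvgrPdist_le => e e_gt0.
move/cvgrPdist_le/(_ _ e_gt0): f_lim; rewrite near_dnbhs; apply: filterS => q.
by have [->|_ /(_ isT)//] := eqVneq q p; rewrite subrr normr0 ltW.
Qed.

Lemma ord_ge_oppP x f p m :
  ord_ge_opp x f p m <->
  exists2 a, punctured_laurent x f p m a & (m = 0 -> f p = a 0)%N.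
Proof. by split=> [[a /laurentP[]]|[a ? ?]]; exists a => //; exact/laurentP. Qed.

Lemma ord_ge_opp0 x p m : ord_ge_opp x (fun=> 0) p m.
Proof.
apply/ord_ge_oppP; exists (fun=> 0) => //.
by apply: nearW => q; rewrite mulr0; exact: psum_zero.
Qed.

Lemma ord_ge_oppD x f h p m : ord_ge_opp x f p m -> ord_ge_opp x h p m ->
  ord_ge_opp x (fun q => f q + h q) p m.
Proof.
move=> /ord_ge_oppP[a fa fp] /ord_ge_oppP[b hb hp]; apply/ord_ge_oppP.
exists (fun n => a n + b n); first exact: punctured_laurentD.
by move=> m0; rewrite fp // hp.
Qed.

Lemma ord_ge_oppZ x f p m c : ord_ge_opp x f p m ->
  ord_ge_opp x (fun q => c * f q) p m.
Proof.
move=> /ord_ge_oppP[a fa fp]; apply/ord_ge_oppP.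
exists (fun n => c * a n); first exact: punctured_laurentZ.
by move=> m0; rewrite fp.
Qed.

Lemma ord_ge_oppM x f h p m m' : local_coordinate x p ->
  ord_ge_opp x f p m -> ord_ge_opp x h p m' ->
  ord_ge_opp x (fun q => f q * h q) p (m + m').
Proof.
move=> xp /ord_ge_oppP[a fa fp] /ord_ge_oppP[b hb hp]; apply/ord_ge_oppP.
exists (convolution a b); first exact: punctured_laurentM.
move=> /eqP; rewrite addn_eq0 => /andP[/eqP m0 /eqP m'0].
by rewrite /convolution big_ord1 fp // hp.
Qed.

Lemma ord_ge_opp_widen x f p m m' : (m <= m')%N ->
  ord_ge_opp x f p m -> ord_ge_opp x f p m'.
Proof.
move=> mm' /ord_ge_oppP[a fa fp]; case: m' mm' => [|m'] mm'.
  by move: mm'; rewrite leqn0 => /eqP m0; rewrite -m0; apply/ord_ge_oppP; exists a.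
have [b fb] := punctured_laurent_widen mm' fa.
by apply/ord_ge_oppP; exists b.
Qed.

End LaurentExpansions.

(** * Meromorphic sections *)

Section Sections.
Variables (R : realType) (X : topologicalType) (S : riemann_surface R X).
Local Notation C := (Cplx R).
Local Notation coord := Defs.coord.
Implicit Types (s t w : section S) (D E : X -> nat) (i j : chart S) (p q : X).

Lemma near_dom i p : dom i p -> \forall q \near p, dom i q.
Proof. by move=> ip; exact: open_nbhs_nbhs (conj (dom_open i) ip). Qed.

Lemma chart_local_coordinate i p : dom i p -> local_coordinate (coord i) p.
Proof.
move=> ip; split.
- have := @coord_cont _ _ S i; rewrite continuous_open_subspace; last exact: dom_open.
  by apply; rewrite inE.
- apply: filterS (near_dom ip) => q iq.
  by apply: (@coord_inj _ _ S i); rewrite inE.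
- (* The chart would map an isolated point to an open singleton of [C]. *)
  apply: Build_ProperFilter => p0.
  have [V [V_open Vp Vsub]] : exists V : set X, [/\ open V, V p & V `<=` [set p]].
    move: p0; rewrite /dnbhs /within /= nbhsE => -[V [oV Vp] Vs]; exists V.
    by split=> // q /Vs; apply: contraPP => /eqP qp; exact.
  have V_dom : V `<=` dom i by move=> q /Vsub ->.
  have := coord_open V_open V_dom.
  rewrite openE => /(_ (coord i p)); case; first by exists p.
  move=> e /= e_gt0 /(_ (coord i p + e / 2)); case.
    rewrite /= opprD addrA subrr sub0r normrN ger0_norm; last by rewrite divr_ge0 // ltW.
    by rewrite ltr_pdivrMr // mulr_natr mulr2n ltrDr.
  move=> q /Vsub ->; rewrite -[X in X = _]addr0 => /addrI /esym /eqP.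
  by rewrite mulf_eq0 invr_eq0 pnatr_eq0 orbF gt_eqF.
Qed.

Lemma near_divisor D p : is_divisor D -> \forall q \near p^', D q = 0%N.
Proof.
move=> D_fin; pose A := [set q | D q != 0%N] `\ p.
have A_closed : closed A.
  apply: (accessible_finite_set_closed.1 (hausdorff_accessible (surface_hausdorff S))).
  by apply: (sub_finite_set _ D_fin) => q [].
have : nbhs p (~` A).
  by apply: open_nbhs_nbhs; split; [exact: closed_openC | by move=> [_ /(_ erefl)]].
rewrite near_dnbhs; apply: filterS => q Aq qp; apply/eqP; apply/negPn/negP => Dq.
by apply: Aq; split=> // /eqP; rewrite (negbTE qp).
Qed.

Lemma mero_eq_trans s t w : mero_eq s t -> mero_eq t w -> mero_eq s w.
Proof. by move=> st tw i p ip; apply: filterS2 (st i p ip) (tw i p ip) => q ->. Qed.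

Definition zero_section : section S := fun _ _ => 0.

Definition add_section s t : section S := fun i p => s i p + t i p.

(** Multiplication of a section by a function. *)
Definition scale_section (f : X -> C) s : section S := fun i p => f p * s i p.

(** Linear combinations of the first [n] terms of a sequence of sections; the
    coefficients are also a sequence, of which only the first [n] terms matter. *)
Definition comb n (v : nat -> C) (b : nat -> section S) : section S :=
  fun i p => \sum_(l < n) v l * b l i p.

Lemma combS n v b :
  comb n.+1 v b = add_section (comb n v b) (scale_section (fun=> v n) (b n)).
Proof. by apply/funext => i; apply/funext => p; rewrite /comb big_ord_recr. Qed.

Section Bundle.
Variable g : cocycle S.
Hypothesis g_continuous : forall i j p, dom i p -> dom j p ->
  {for p, continuous (g i j)}.

Lemma H0_zero D : H0 g D zero_section.
Proof.
split=> [i j p _ _ _|i p _]; first by rewrite /zero_section mulr0.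
exact: ord_ge_opp0.
Qed.

Lemma H0D D s t : H0 g D s -> H0 g D t -> H0 g D (add_section s t).
Proof.
move=> [s1 s2] [t1 t2]; split=> [i j p ip jp Dp|i p ip].
  by rewrite /add_section (s1 i j) // (t1 i j) // mulrDr.
exact: ord_ge_oppD (s2 i p ip) (t2 i p ip).
Qed.

Lemma H0Z D c s : H0 g D s -> H0 g D (scale_section (fun=> c) s).
Proof.
move=> [s1 s2]; split=> [i j p ip jp Dp|i p ip].
  by rewrite /scale_section (s1 i j) // mulrCA.
exact: ord_ge_oppZ (s2 i p ip).
Qed.

Lemma H0_comb D n v b : (forall l, (l < n)%N -> H0 g D (b l)) -> H0 g D (comb n v b).
Proof.
elim: n => [|n IHn] bD.
  suff -> : comb 0 v b = zero_section by exact: H0_zero.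
  by apply/funext => i; apply/funext => p; rewrite /comb big_ord0.
rewrite combS; apply: H0D; last by apply: H0Z; exact: bD.
by apply: IHn => l ln; apply: bD; rewrite ltnS ltnW.
Qed.

Lemma H0_widen D E s : (forall p, D p <= E p)%N -> H0 g D s -> H0 g E s.
Proof.
move=> DE [s1 s2]; split=> [i j p ip jp Ep|i p ip].
  by apply: s1 => //; apply/eqP; rewrite -leqn0 -Ep.
exact: ord_ge_opp_widen (DE p) (s2 i p ip).
Qed.

(** Away from the poles, equality of meromorphic sections is equality of values. *)
Lemma mero_eq_value D E s t i p : H0 g D s -> H0 g E t -> mero_eq s t ->
  dom i p -> D p = 0%N -> E p = 0%N -> s i p = t i p.
Proof.
move=> [_ sD] [_ tE] st ip Dp Ep; have xp := chart_local_coordinate ip.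
have [_ _ pp] := xp.
have hol u F : F p = 0%N -> (forall i p, dom i p -> ord_ge_opp (coord i) (u i) p (F p)) ->
    u i q @[q --> p^'] --> u i p.
  move=> Fp uF; apply: (cvg_trans (cvg_app (u i) (@nbhs_dnbhs _ p))).
  by apply: (holomorphic_continuous xp); have := uF i p ip; rewrite Fp.
apply: cvg_unique_Cplx (hol _ _ Dp sD) _; apply: cvg_trans (hol _ _ Ep tE).
by apply: near_eq_cvg; apply: filterS (st i p ip).
Qed.

(** Riemann's extension theorem for sections: the values at the points of [D]
    can be corrected. *)
Lemma H0_removable D s : is_divisor D -> H0 g D s ->
  (forall i p, dom i p -> exists a, punctured_laurent (coord i) (s i) p 0 a) ->
  exists2 t, H0 g (fun=> 0%N) t & mero_eq s t.
Proof.
move=> D_fin [s1 s2] s_rem.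
pose t : section S := fun i p =>
  if D p == 0%N then s i p else lim (s i q @[q --> p^']).
have st : mero_eq s t.
  by move=> i p ip; apply: filterS (near_divisor p D_fin) => q Dq; rewrite /t Dq eqxx.
have s_lim i p a : dom i p -> punctured_laurent (coord i) (s i) p 0 a ->
    s i q @[q --> p^'] --> a 0%N.
  move=> ip sa.
  apply: cvg_ext (punctured_laurent_lim (chart_local_coordinate ip) sa) _ _ => // q.
  by rewrite expr0 mul1r.
have t_val i p a : dom i p -> punctured_laurent (coord i) (s i) p 0 a ->
    D p != 0%N -> t i p = a 0%N.
  move=> ip sa /negbTE Dp; rewrite /t Dp.
  have [_ _ pp] := chart_local_coordinate ip.
  by apply: cvg_lim; [exact: norm_hausdorff | exact: s_lim].
exists t => //; split=> [i j p ip jp _|i p ip].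
  have [Dp|Dp] := eqVneq (D p) 0%N; first by rewrite /t Dp eqxx (s1 i j).
  (* At a point of [D] the transition rule is the limit of the rule at the points
     nearby, since [g] is continuous. *)
  have [a sa] := s_rem i p ip; have [b sb] := s_rem j p jp.
  rewrite (t_val i p a) // (t_val j p b) //.
  have [_ _ pp] := chart_local_coordinate ip.
  apply: cvg_unique_Cplx (s_lim _ _ _ ip sa) _.
  have g_lim : g i j q @[q --> p^'] --> g i j p.
    exact: cvg_trans (cvg_app (g i j) (@nbhs_dnbhs _ p)) (g_continuous ip jp).
  apply: cvg_trans (cvgM g_lim (s_lim _ _ _ jp sb)); apply: near_eq_cvg.
  have ijp : \forall q \near p^', dom i q /\ dom j q.
    by apply: nbhs_dnbhs; apply: filterI; exact: near_dom.
  apply: filterS2 ijp (near_divisor p D_fin) => q [iq jq] Dq.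
  by rewrite (s1 i j).
apply/ord_ge_oppP.
have tP a : punctured_laurent (coord i) (s i) p 0 a ->
    punctured_laurent (coord i) (t i) p 0 a.
  by move=> sa; apply: filterS2 (st i p ip) sa => q ->.
have [Dp|Dp] := eqVneq (D p) 0%N.
  have := s2 i p ip; rewrite Dp => /ord_ge_oppP[a sa sp]; exists a; first exact: tP.
  by rewrite /t Dp.
have [a sa] := s_rem i p ip; exists a; first exact: tP.
by move=> _; exact: t_val.
Qed.

End Bundle.

End Sections.

(** * Sections generated over the polynomials in [Z] *)

Section Generation.
Variables (R : realType) (X : topologicalType) (S : riemann_surface R X).
Local Notation C := (Cplx R).
Local Notation coord := Defs.coord.
Variable g : cocycle S.
Hypothesis g_continuous : forall i j p, dom i p -> dom j p ->
  {for p, continuous (g i j)}.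
Hypothesis g_h0 : is_trivial (H0 g (fun=> 0%N)).
Variables (Z : X -> option C) (Xi : X -> nat).
Hypothesis Z_mero : mero_function S Z Xi.
Variables (r : nat) (r_gt0 : (0 < r)%N) (phi : 'I_r -> section S).
Hypothesis phi_basis : is_basis (H0 g Xi) phi.
Implicit Types (s t w : section S) (D : X -> nat) (v : nat -> C).
Implicit Types (i j : chart S) (p q : X).

(** The finite values of [Z], extended by [0] to its poles. *)
Definition finite_part (p : X) : C := odflt 0 (Z p).

Lemma finite_part_ord i p : dom i p -> ord_ge_opp (coord i) finite_part p (Xi p).
Proof.
case: Z_mero => _ _ /(_ i p) H ip; have := H ip.
by case: eqP => [->//|_ [a [fa _]]]; exists a.
Qed.

Lemma H0_finite_part D s : H0 g D s ->
  H0 g (fun p => Xi p + D p)%N (scale_section finite_part s).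
Proof.
move=> [s1 s2]; split=> [i j p ip jp /eqP|i p ip].
  rewrite addn_eq0 => /andP[_ /eqP Dp].
  by rewrite /scale_section (s1 i j) // mulrCA.
exact: ord_ge_oppM (chart_local_coordinate ip) (finite_part_ord ip) (s2 i p ip).
Qed.

(** Multiplication by [Z] raises the order of every pole on the support of [Xi]
    by [Xi], so the only section of [g(m Xi)] that it sends into [H0 g Xi] is
    holomorphic, hence zero. *)
Lemma scale_finite_part_eq0 m s w : H0 g (fun p => m * Xi p)%N s -> H0 g Xi w ->
  mero_eq (scale_section finite_part s) w -> mero_eq s (@zero_section R X S).
Proof.
move=> sm [_ wXi] sw; have [Xi_fin _ Z_ord] := Z_mero.
pose D p := (m * Xi p)%N.
have D_fin : is_divisor D.
  apply: sub_finite_set Xi_fin => p; rewrite /D /=; apply: contraNN => /eqP ->.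
  by rewrite muln0.
suff s_rem i p : dom i p -> exists a, punctured_laurent (coord i) (s i) p 0 a.
  have [t t0 st] := H0_removable g_continuous D_fin sm s_rem.
  exact: mero_eq_trans st (g_h0 t0).
move=> ip; have xp := chart_local_coordinate ip.
have /ord_ge_oppP[a sa _] := sm.2 i p ip.
have [Xip|Xip] := eqVneq (Xi p) 0%N.
  by exists a; move: sa; rewrite Xip muln0.
have := Z_ord i p ip; rewrite /= (negbTE Xip) => -[b [/laurentP[Zb _] b0]].
have /ord_ge_oppP[c wc _] := wXi i p ip.
exact: removable_singularity xp sa Zb b0 wc (sw i p ip).
Qed.

(** The sections [Z ^ j * phi c], in the order given by [n = r * j + c]. *)
Definition power_section (n : nat) : section S := fun i p =>
  finite_part p ^+ (n %/ r) * phi (Ordinal (ltn_pmod n r_gt0)) i p.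

Lemma power_section_lt (c : 'I_r) : power_section c = phi c.
Proof.
apply/funext => i; apply/funext => p; rewrite /power_section divn_small // mul1r.
by congr (phi _ i p); apply/val_inj; rewrite /= modn_small.
Qed.

Lemma power_sectionD n :
  power_section (r + n) = scale_section finite_part (power_section n).
Proof.
apply/funext => i; apply/funext => p.
rewrite /power_section /scale_section divnDl ?dvdnn // divnn r_gt0 add1n exprS mulrA.
by congr (_ * phi _ i p); apply/val_inj; rewrite /= modnDl.
Qed.

Lemma power_section_H0 m n : (n < r * m)%N ->
  H0 g (fun p => m * Xi p)%N (power_section n).
Proof.
elim: m n => [|m IHm] n; first by rewrite muln0.
have [nr _|rn] := ltnP n r.
  rewrite -[n]/(val (Ordinal nr)) power_section_lt.
  have [phiV _ _] := phi_basis; apply: H0_widen (phiV _) => p.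
  by rewrite mulSn leq_addr.
rewrite -(subnKC rn) mulnS ltn_add2l => /IHm /H0_finite_part.
by rewrite power_sectionD; apply: H0_widen => p; rewrite mulSn.
Qed.

Lemma comb_power_section m v : comb (r + m) v power_section =
  add_section (lincomb (fun c : 'I_r => v c) phi)
    (scale_section finite_part (comb m (fun n => v (r + n)%N) power_section)).
Proof.
apply/funext => i; apply/funext => p.
rewrite /comb /add_section /scale_section /lincomb big_split_ord /=.
congr (_ + _); first by apply: eq_bigr => c _; rewrite power_section_lt.
rewrite mulr_sumr; apply: eq_bigr => n _.
by rewrite power_sectionD /scale_section mulrCA.
Qed.

(** Separating the terms free of [Z], a relation reads [T * Z + w = 0] with [w]
    in [H0 g Xi], so that [T] vanishes, and then [w] too. *)
Lemma power_section_free m v :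
  mero_eq (comb (r * m) v power_section) (@zero_section R X S) ->
  forall n, (n < r * m)%N -> v n = 0.
Proof.
elim: m v => [|m IHm] v; first by rewrite muln0.
rewrite mulnS comb_power_section; set T := comb _ _ _ => vT.
have [phiV phi_free _] := phi_basis.
have T_H0 : H0 g (fun p => m * Xi p)%N T.
  by apply: H0_comb => n; exact: power_section_H0.
pose w := lincomb (fun c : 'I_r => - v c) phi.
have wE : w = scale_section (fun=> -1) (lincomb (fun c : 'I_r => v c) phi).
  apply/funext => i; apply/funext => p; rewrite /w /lincomb /scale_section mulr_sumr.
  by apply: eq_bigr => c _; rewrite mulrA mulN1r.
have w_H0 : H0 g Xi w.
  have -> : w = comb r (fun n => - v n) power_section.
    apply/funext => i; apply/funext => p; apply: eq_bigr => c _.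
    by rewrite power_section_lt.
  apply: H0_comb => n nr.
  by have := @power_section_lt (Ordinal nr) => /= ->; exact: phiV.
have Tw : mero_eq (scale_section finite_part T) w.
  move=> i p ip; apply: filterS (vT i p ip) => q /eqP.
  rewrite wE /add_section /zero_section addrC addr_eq0 => /eqP ->.
  by rewrite /scale_section mulN1r.
have T0 := scale_finite_part_eq0 T_H0 w_H0 Tw.
have v_lo : forall c : 'I_r, v c = 0.
  apply: phi_free => i p ip; apply: filterS2 (vT i p ip) (T0 i p ip) => q.
  by rewrite /add_section /scale_section => vq Tq; move: vq; rewrite Tq mulr0 addr0.
move=> n; have [nr _|rn] := ltnP n r; first exact: (v_lo (Ordinal nr)).
rewrite -(subnKC rn) ltn_add2l; exact: (IHm (fun n => v (r + n)%N)).
Qed.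

Variable D : nat -> X -> nat.
Hypothesis D0 : forall p, D 0 p = 0%N.
Hypothesis D_incr : forall n p, (D n p <= D n.+1 p)%N.
Hypothesis D_mul : forall k p, D (r * k)%N p = (k * Xi p)%N.
Variable psi : nat -> section S.
Hypothesis psi_spans : forall n, spans_mod (H0 g (D n.+1)) (H0 g (D n)) (psi n).
Hypothesis psi_notin : forall n w, H0 g (D n) w -> ~ mero_eq (psi n) w.

Lemma D_leq m n p : (m <= n)%N -> (D m p <= D n p)%N.
Proof.
move=> mn; rewrite -(subnKC mn); elim: (n - m)%N => [|d IHd]; first by rewrite addn0.
by rewrite addnS (leq_trans IHd).
Qed.

Lemma H0_psi_comb n s : H0 g (D n) s -> exists v, mero_eq s (comb n v psi).
Proof.
elim: n s => [|n IHn] s sD.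
  exists (fun=> 0); have -> : comb 0 (fun=> 0) psi = @zero_section R X S.
    by apply/funext => i; apply/funext => p; rewrite /comb big_ord0.
  by apply: g_h0; apply: H0_widen sD => p; rewrite D0.
have [_ /(_ s sD)[c [w [/IHn[v wv] sw]]]] := psi_spans n.
exists (fun l => if l == n then c else v l).
apply: mero_eq_trans sw _; rewrite combS eqxx.
have -> : comb n (fun l => if l == n then c else v l) psi = comb n v psi.
  apply/funext => i; apply/funext => p; apply: eq_bigr => l _.
  by rewrite ltn_eqF.
move=> i p ip; apply: filterS (wv i p ip) => q.
by rewrite /add_section /scale_section => ->; rewrite addrC.
Qed.

(** The [r * m] independent sections [power_section] lie in [H0 g (m Xi)], which
    the first [r * m] sections [psi] span; the matrix expressing the former in
    the latter is therefore invertible. *)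
Lemma psi_power_comb m n : (n < r * m)%N ->
  exists v, mero_eq (psi n) (comb (r * m) v power_section).
Proof.
move=> nm.
have ex (l : 'I_(r * m)) : exists v, mero_eq (power_section l) (comb (r * m) v psi).
  apply: H0_psi_comb; apply: H0_widen (power_section_H0 (ltn_ord l)) => p.
  by rewrite D_mul.
pose A : 'M[C]_(r * m) := \matrix_(l, l') projT1 (cid (ex l)) l'.
have AP (l : 'I_(r * m)) i p : dom i p -> \forall q \near p^',
    power_section l i q = \sum_l' A l l' * psi l' i q.
  move=> ip; apply: filterS (projT2 (cid (ex l)) i p ip) => q ->.
  by apply: eq_bigr => l' _; rewrite mxE.
have all_AP i p : dom i p -> \forall q \near p^', forall l : 'I_(r * m),
    power_section l i q = \sum_l' A l l' * psi l' i q.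
  by move=> ip; apply: filter_forall => l; exact: AP.
have combA (u : 'rV[C]_(r * m)) i p : dom i p -> \forall q \near p^',
    \sum_l u 0 l * power_section l i q = \sum_l' (u *m A) 0 l' * psi l' i q.
  move=> ip; apply: filterS (all_AP i p ip) => q qA.
  under eq_bigr do rewrite qA mulr_sumr.
  rewrite exchange_big /=; apply: eq_bigr => l' _; rewrite mxE mulr_suml.
  by apply: eq_bigr => l _; rewrite mulrA.
(* [A] is square, and a row vector that it kills is a relation between the
   sections [power_section l]. *)
have A_unit : A \in unitmx.
  rewrite -row_free_unit; apply: inj_row_free => u uA.
  (* [v] is [u] extended by zero. *)
  pose v l := if insub l is Some l' then u 0 l' else 0.
  have vE (l : 'I_(r * m)) : v l = u 0 l by rewrite /v valK.
  apply/rowP => l; rewrite mxE -vE; apply: (power_section_free (m := m)) => // i p ip.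
  apply: filterS (combA u i p ip) => q; rewrite uA /comb.
  move=> uq; transitivity (\sum_l u 0 l * power_section l i q).
    by apply: eq_bigr => l' _; rewrite vE.
  by rewrite uq big1 // => l' _; rewrite mxE mul0r.
pose u := row (Ordinal nm) (invmx A).
pose v l := if insub l is Some l' then u 0 l' else 0.
have vE (l : 'I_(r * m)) : v l = u 0 l by rewrite /v valK.
exists v => i p ip; apply: filterS (combA u i p ip) => q.
move=> uq; transitivity (\sum_l u 0 l * power_section l i q); last first.
  by apply: eq_bigr => l _; rewrite vE.
rewrite uq -row_mul mulVmx // (bigD1 (Ordinal nm)) //= !mxE eqxx mul1r big1 ?addr0 //.
by move=> l /negbTE ln; rewrite !mxE eq_sym ln mul0r.
Qed.

(** Euclidean division by [r] maps [n < r * m] bijectively to the pairs [(j, c)]. *)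
Lemma sum_divmod m (F : nat -> nat -> C) :
  \sum_(n < r * m) F (n %/ r)%N (n %% r)%N = \sum_(c < r) \sum_(j < m) F j c.
Proof.
rewrite exchange_big /= mulnC; elim: m => [|m IHm]; first by rewrite !big_ord0.
rewrite big_ord_recr /= mulSnr big_split_ord /= -IHm; congr (_ + _).
by apply: eq_bigr => c _; rewrite divnMDl // modnMDl divn_small // addn0 modn_small.
Qed.

(** The degree of [P] is exactly [k]: if all the coefficients of [z ^ k] in the
    first row vanished, then [psi (r * k)] would lie in [H0 g (k Xi)]. *)
Lemma psi_matrix_polynomial k : exists P : 'M[{poly C}]_r, mpoly_degree P k /\
  forall z p i, Z p = Some z -> dom i p -> forall a : 'I_r,
    psi (r * k + a)%N i p = \sum_c (P a c).[z] * phi c i p.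
Proof.
have lt_rk (a : 'I_r) : (r * k + a < r * k.+1)%N by rewrite mulnSr ltn_add2l.
have ex (a : 'I_r) := psi_power_comb (lt_rk a).
pose v (a : 'I_r) := projT1 (cid (ex a)).
have vP (a : 'I_r) : mero_eq (psi (r * k + a)%N) (comb (r * k.+1) (v a) power_section).
  exact: (projT2 (cid (ex a))).
pose P : 'M[{poly C}]_r := \matrix_(a, c) \poly_(j < k.+1) v a (r * j + c)%N.
exists P; split; last first.
  move=> z p i Zp ip a.
  (* The point [p] is not a pole, so the two meromorphic sections have the same
     value there. *)
  have Xip : Xi p = 0%N.
    have [_ /(_ p) ZXi _] := Z_mero.
    by apply/eqP; apply/negPn/negP => /ZXi; rewrite Zp.
  have [psiD _] := psi_spans (r * k + a).
  have combD : H0 g (D (r * k.+1)) (comb (r * k.+1) (v a) power_section).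
    apply: H0_comb => n nk; apply: H0_widen (power_section_H0 nk) => q.
    by rewrite D_mul.
  have Dp : D (r * k.+1) p = 0%N by rewrite D_mul Xip muln0.
  have Dp' : D (r * k + a).+1 p = 0%N.
    by apply/eqP; rewrite -leqn0 -Dp; exact: D_leq.
  rewrite (mero_eq_value psiD combD (vP a) ip Dp' Dp) /comb.
  transitivity (\sum_(n < r * k.+1)
      v a (r * (n %/ r) + n %% r)%N * (z ^+ (n %/ r) *
        phi (Ordinal (ltn_pmod (n %% r) r_gt0)) i p)).
    apply: eq_bigr => n _.
    have -> : (r * (n %/ r) + n %% r)%N = n by rewrite mulnC -divn_eq.
    rewrite /power_section /finite_part Zp /=.
    by congr (_ * (_ * phi _ i p)); apply/val_inj; rewrite /= modn_mod.
  rewrite (sum_divmod k.+1 (fun d c => v a (r * d + c)%N * (z ^+ d *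
             phi (Ordinal (ltn_pmod c r_gt0)) i p))).
  apply: eq_bigr => c _; rewrite mxE horner_poly mulr_suml; apply: eq_bigr => j _.
  rewrite mulrA; congr (_ * phi _ i p); apply/val_inj.
  by rewrite /= modn_small.
split=> [a c|]; first by rewrite mxE size_poly.
apply: contrapT => P0.
pose a0 := Ordinal r_gt0.
have v0 (c : 'I_r) : v a0 (r * k + c)%N = 0.
  apply: contrapT => /eqP vc; apply: P0; exists a0, c.
  by rewrite mxE coef_poly ltnSn.
have comb_H0 : H0 g (D (r * k)) (comb (r * k) (v a0) power_section).
  apply: H0_comb => n nk; apply: H0_widen (power_section_H0 nk) => q.
  by rewrite D_mul.
apply: (psi_notin comb_H0); have := vP a0; rewrite /= addn0.
suff -> : comb (r * k.+1) (v a0) power_section = comb (r * k) (v a0) power_section.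
  by [].
apply/funext => i; apply/funext => p; rewrite /comb mulnSr big_split_ord /=.
by rewrite [X in _ + X]big1 ?addr0 // => c _; rewrite v0 mul0r.
Qed.

End Generation.

(** * Moments and continuity of the transition functions *)

Section Twist.
Variables (R : realType) (X : topologicalType) (S : riemann_surface R X).
Local Notation C := (Cplx R).

Lemma tensor_continuous (L h : cocycle S) : line_bundle h ->
  (forall i j p, dom i p -> dom j p -> \forall q \near p, L i j q = L i j p) ->
  forall i j p, dom i p -> dom j p -> {for p, continuous (tensor L h i j)}.
Proof.
move=> [_ h_hol] L_const i j p ip jp.
have h_cont : h i j q @[q --> p] --> h i j p.
  exact: holomorphic_continuous (chart_local_coordinate ip) (h_hol i j p ip jp).
have L_cont : L i j q @[q --> p] --> L i j p.
  apply/cvgrPdist_le => e e_gt0; apply: filterS (L_const i j p ip jp) => q ->.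
  by rewrite subrr normr0 ltW.
exact: cvgM L_cont h_cont.
Qed.

(** If [s] already belongs to the smaller space, the two spaces coincide, and zero
    spans the larger modulo the smaller. *)
Lemma spans_mod_zero (g : cocycle S) (D D' : X -> nat) (s w : section S) :
  spans_mod (H0 g D') (H0 g D) s -> H0 g D w -> mero_eq s w ->
  spans_mod (H0 g D') (H0 g D) (@zero_section R X S).
Proof.
move=> [_ s_spans] wD sw; split=> [|s' /s_spans[c [w' [w'D s'E]]]].
  exact: H0_zero.
exists 0, (add_section (scale_section (fun=> c) w) w'); split.
  exact: H0D (H0Z c wD) w'D.
move=> i p ip; apply: filterS2 (s'E i p ip) (sw i p ip) => q -> ->.
by rewrite mul0r add0r.
Qed.

Variables (N : nat) (gam : 'I_N -> R -> X) (Y : X -> C).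

Lemma pairing_eq0 (s s' : section S) :
  (forall j t, pullback Y (gam j) s s' t = 0) -> pairing gam Y s s' = 0.
Proof.
move=> ss'0; apply: big1 => j _; rewrite /cintegral.
have -> : pullback Y (gam j) s s' = fun=> 0 by apply/funext => t; exact: ss'0.
have -> : Re_of (fun=> 0 : C) = fun=> 0 by [].
have -> : Im_of (fun=> 0 : C) = fun=> 0 by [].
by rewrite /Rintegral integral0 /=.
Qed.

Lemma pairing0l (s : section S) : pairing gam Y (@zero_section R X S) s = 0.
Proof. by apply: pairing_eq0 => j t; rewrite /pullback mulr0 !mul0r. Qed.

Lemma pairing0r (s : section S) : pairing gam Y s (@zero_section R X S) = 0.
Proof. by apply: pairing_eq0 => j t; rewrite /pullback mulr0 mul0r. Qed.

Section Moments.
Variables (g h : cocycle S) (D : nat -> X -> nat).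
Hypothesis moments : forall ch chv : nat -> section S,
  (forall a, spans_mod (H0 g (D a.+1)) (H0 g (D a)) (ch a)) ->
  (forall a, spans_mod (H0 h (D a.+1)) (H0 h (D a)) (chv a)) ->
  forall n, (1 <= n)%N ->
    \det (\matrix_(a < n, b < n) pairing gam Y (ch a) (chv b)) != 0.
Variables psi psiv : nat -> section S.
Hypothesis psi_spans : forall n, spans_mod (H0 g (D n.+1)) (H0 g (D n)) (psi n).
Hypothesis psiv_spans : forall n, spans_mod (H0 h (D n.+1)) (H0 h (D n)) (psiv n).

(** If [psi n] were in the preceding space, the zero section could replace it in
    a spanning sequence, and a moment matrix would have a zero row. *)
Lemma moments_notin n (w : section S) : H0 g (D n) w -> ~ mero_eq (psi n) w.
Proof.
move=> wD psi_w.
pose ch a := if a == n then @zero_section R X S else psi a.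
have ch_spans a : spans_mod (H0 g (D a.+1)) (H0 g (D a)) (ch a).
  rewrite /ch; case: eqP => [->|_ //].
  exact: spans_mod_zero (psi_spans n) wD psi_w.
have /eqP := moments ch_spans psiv_spans (ltn0Sn n); apply.
rewrite (expand_det_row _ ord_max) big1 // => b _.
by rewrite mxE /ch eqxx pairing0l mul0r.
Qed.

Lemma moments_notin_dual n (w : section S) : H0 h (D n) w -> ~ mero_eq (psiv n) w.
Proof.
move=> wD psi_w.
pose ch a := if a == n then @zero_section R X S else psiv a.
have ch_spans a : spans_mod (H0 h (D a.+1)) (H0 h (D a)) (ch a).
  rewrite /ch; case: eqP => [->|_ //].
  exact: spans_mod_zero (psiv_spans n) wD psi_w.
have /eqP := moments psi_spans ch_spans (ltn0Sn n); apply.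
rewrite (expand_det_col _ ord_max) big1 // => b _.
by rewrite mxE /ch eqxx pairing0r mul0r.
Qed.

End Moments.
End Twist.

Lemma divisor_deg_eq0 (X : topologicalType) (D : X -> nat) :
  is_divisor D -> divisor_deg D = 0%N -> forall p, D p = 0%N.
Proof.
move=> D_fin D0 p; apply/eqP/negPn/negP => Dp.
move: D0; rewrite /divisor_deg -(fsbig_widen [set q | D q != 0%N]) //; last first.
  by move=> q /= [_ /negP]; rewrite negbK => /eqP.
rewrite (fsbigD1 p) //= => /eqP; rewrite addn_eq0 => /andP[p0 _].
by rewrite p0 in Dp.
Qed.

(** * Biorthogonal sections as matrix polynomials *)

Theorem corollary3p4
  (R : realType) (X : topologicalType) (S : riemann_surface R X) (g : nat)
  (X_compact : compact [set: X]) (X_genus : has_genus S g)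
  (* the square root of the canonical bundle and the flat line bundle *)
  (sqrtK : cocycle S) (sqrtK_sqrt : sqrt_canonical sqrtK)
  (sqrtK_h0 : is_trivial (H0 sqrtK (fun=> 0%N)))
  (x0 : X) (chi : (R -> X) -> Cplx R) (chi_char : unitary_character x0 chi)
  (L : cocycle S) (L_flat : flat_bundle x0 chi L)
  (L_h0 : is_trivial (H0 (tensor L sqrtK) (fun=> 0%N)))
  (Lv_h0 : is_trivial (H0 (tensor (dual L) sqrtK) (fun=> 0%N)))
  (* the meromorphic function and its polar divisor *)
  (r : nat) (r_gt0 : (0 < r)%N)
  (Z : X -> option (Cplx R)) (Xi : X -> nat)
  (Z_mero : mero_function S Z Xi) (Z_deg : divisor_deg Xi = r)
  (* the sequence of divisors *)
  (D : nat -> X -> nat) (Rem : nat -> X -> nat)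
  (D_supp : forall n, is_divisor (D n))
  (D_deg : forall n, divisor_deg (D n) = n)
  (D_incr : forall n p, (D n p <= D n.+1 p)%N)
  (D_form : forall k l p, (l < r)%N ->
     D (k * r + l)%N p = (k * Xi p + Rem l p)%N)
  (Rem_le : forall l p, (l < r)%N -> (Rem l p <= Xi p)%N)
  (Rem_deg : forall l, (l < r)%N -> divisor_deg (Rem l) = l)
  (* the contour and the weight *)
  (N : nat) (gam : 'I_N -> R -> X) (gam_contour : contour S gam)
  (gam_off : forall j t n, 0 < t < 1 -> D n (gam j t) = 0%N)
  (Y : X -> Cplx R) (Y_smooth : smooth_on gam Y)
  (Y_conv : forall n m phi phiv,
     H0 (tensor L sqrtK) (D n) phi -> H0 (tensor (dual L) sqrtK) (D m) phiv ->
     pairing_converges gam Y phi phiv)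
  (* nonvanishing of the moment determinants *)
  (moments : forall ch chv : nat -> section S,
     (forall a, spans_mod (H0 (tensor L sqrtK) (D a.+1))
                          (H0 (tensor L sqrtK) (D a)) (ch a)) ->
     (forall a, spans_mod (H0 (tensor (dual L) sqrtK) (D a.+1))
                          (H0 (tensor (dual L) sqrtK) (D a)) (chv a)) ->
     forall n, (1 <= n)%N ->
       \det (\matrix_(a < n, b < n) pairing gam Y (ch a) (chv b)) != 0)
  (* the biorthogonal sections *)
  (psi psiv : nat -> section S)
  (psi_spans : forall n, spans_mod (H0 (tensor L sqrtK) (D n.+1))
                                   (H0 (tensor L sqrtK) (D n)) (psi n))
  (psiv_spans : forall n, spans_mod (H0 (tensor (dual L) sqrtK) (D n.+1))
                                    (H0 (tensor (dual L) sqrtK) (D n)) (psiv n))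
  (psi_orth : forall n phiv, H0 (tensor (dual L) sqrtK) (D n) phiv ->
     pairing gam Y (psi n) phiv = 0)
  (psiv_orth : forall n phi, H0 (tensor L sqrtK) (D n) phi ->
     pairing gam Y phi (psiv n) = 0)
  (* the labelling of the points of the fibres of Z *)
  (cut : set (Cplx R)) (pt : 'I_r -> Cplx R -> X)
  (pt_label : labelling Z cut pt)
  (* arbitrary bases *)
  (phi phiv : 'I_r -> section S)
  (phi_basis : is_basis (H0 (tensor L sqrtK) Xi) phi)
  (phiv_basis : is_basis (H0 (tensor (dual L) sqrtK) Xi) phiv) :
  forall k : nat, exists P Pv : 'M[{poly Cplx R}]_r,
    [/\ mpoly_degree P k, mpoly_degree Pv k
      & forall z : Cplx R, ~ cut z ->
        (* the fibres at z^(1), ..., z^(r) are identified with C by arbitrary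
           local trivializations *)
        forall i : 'I_r -> chart S, (forall b, dom (i b) (pt b z)) ->
          let Psi := \matrix_(a < r, b < r) psi (r * k + a)%N (i b) (pt b z) in
          let Psiv := \matrix_(a < r, b < r) psiv (r * k + b)%N (i a) (pt a z) in
          let Phi := \matrix_(a < r, b < r) phi a (i b) (pt b z) in
          let Phiv := \matrix_(a < r, b < r) phiv b (i a) (pt a z) in
          Psi = mpoly_eval P z *m Phi /\ Psiv = Phiv *m mpoly_eval Pv z].
Proof.
have D0 p : D 0 p = 0%N by exact: divisor_deg_eq0 (D_supp 0) (D_deg 0) p.
have D_mul k p : D (r * k)%N p = (k * Xi p)%N.
  have := D_form 0 0 p r_gt0; rewrite D0 mul0n add0n => Rem0.
  by have := D_form k 0 p r_gt0; rewrite addn0 -Rem0 addn0 mulnC.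
have [_ _ L_const _] := L_flat; have [sqrtK_bundle _] := sqrtK_sqrt.
have E_cont := tensor_continuous sqrtK_bundle L_const.
have Lv_const i j p : dom i p -> dom j p ->
    \forall q \near p, dual L i j q = dual L i j p.
  by move=> ip jp; apply: filterS (L_const i j p ip jp) => q; rewrite /dual => ->.
have Ev_cont := tensor_continuous sqrtK_bundle Lv_const.
have psi_notin := moments_notin moments psi_spans psiv_spans.
have psiv_notin := moments_notin_dual moments psi_spans psiv_spans.
move=> k.
have [P [P_deg PE]] := psi_matrix_polynomial E_cont L_h0 Z_mero r_gt0 phi_basis
  D0 D_incr D_mul psi_spans psi_notin k.
have [Q [Q_deg QE]] := psi_matrix_polynomial Ev_cont Lv_h0 Z_mero r_gt0 phiv_basis
  D0 D_incr D_mul psiv_spans psiv_notin k.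
exists P, Q^T; split=> //.
  have [Q_size [a [b Qab]]] := Q_deg.
  by split=> [c d|]; [rewrite mxE | exists b, a; rewrite mxE].
move=> z z_cut i i_dom; have [_ _ /(_ z z_cut)[_ _ pt_fibre]] := pt_label.
have Z_pt b : Z (pt b z) = Some z by apply/pt_fibre; exists b.
split; apply/matrixP => a b; rewrite !mxE.
  by rewrite (PE z) //; apply: eq_bigr => c _; rewrite !mxE.
by rewrite (QE z) //; apply: eq_bigr => c _; rewrite !mxE mulrC.
Qed.
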